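(* Let $Q_k$ be a $K$-subset system. For every ordinal $\alpha$ there exists a $T_0$ space $X$ such that: (1) $X$ is $(\alpha+1)^d$-special and $(\alpha+1)^{wf}$-special; (2) $\overline D(K_m(X))=\overline{KF}(K_m(X))$ and $D_{m+1}(X)=K_{m+1}(X)=KF_{m+1}(X)$ for all $0\le m<\alpha+1$; (3) $X$ is $(\alpha+1)^k$-special.
   Context: $Q(X)$: nonempty compact saturated subsets; filtered family: nonempty, any two members contain a third. A $K$-subset system $Q_k$ assigns to each $T_0$ space $X$ a set $Q_k(X)$ with $\{\uparrow x\mid x\in X\}\subseteq Q_k(X)\subseteq Q(X)$ such that continuous images of $k$-Rudin sets are $k$-Rudin, where a nonempty $A\subseteq X$ is $k$-Rudin if for some filtered $\mathcal K\subseteq Q_k(X)$, $\overline A$ is a minimal closed set meeting every member of $\mathcal K$. $\overline{KF}(X)$: $k$-Rudin sets for $Q_k(X)=Q(X)$; $\overline D(X)=\{A\mid\overline A=\overline D$ for some directed $D\}$. $K(X)$: classes of $k$-Rudin sets under $A\sim B\iff\overline A=\overline B$, open sets $U^*=\{[A]\mid A\cap U\ne\emptyset\}$. $D(X)$, $KF(X)$: $K(X)$ for $Q_k(X)=\{\uparrow x\}$, resp. $Q(X)$; equalities of these spaces identify a class with the common closure of its members. Iterates $K_0(X)=X$, $K_{\beta+1}(X)=K(K_\beta(X))$, unions at limit $\beta$ (similarly $D_\beta$, $KF_\beta$). $\mathrm{rank}_k(X)$: least $\alpha$ with $K_\alpha(X)\cong K_{\alpha+1}(X)$; $X$ is $\alpha^k$-special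 if $\mathrm{rank}_k(X)=\alpha$ and $\alpha$ is least with $K_\alpha(X)$ having a greatest element (in the specialization order); $\alpha^d$-, $\alpha^{wf}$-special analogously with $D$, $KF$. *)

(* Defs.v *)
(* topological spaces are mathcomp-analysis
   [topologicalType]s, subspaces are [set_type A] with the initial topology. *)
From HB Require Import structures.
From mathcomp Require Import all_boot all_order all_algebra.
From mathcomp Require Import all_classical.
From mathcomp Require Import topology.

Unset Printing Implicit Defensive.

Local Open Scope classical_set_scope.

Section Basics.
Context {T : topologicalType}.

Definition spec_le (x y : T) : Prop := closure [set y] x.

Definition upc (x : T) : set T := [set y | spec_le x y].

Definition saturated (A : set T) : Prop :=
  forall x y, A x -> spec_le x y -> A y.

Definition QX : set (set T) :=
  [set K | K !=set0 /\ compact K /\ saturated K].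

Definition filtered (F : set (set T)) : Prop :=
  F !=set0 /\ forall A B, F A -> F B -> exists2 C, F C & C `<=` A `&` B.

Definition meets_all (F : set (set T)) (C : set T) : Prop :=
  forall K, F K -> C `&` K !=set0.

Definition kRudin (Qk : set (set T)) (A : set T) : Prop :=
  A !=set0 /\
  exists F : set (set T), [/\ F `<=` Qk, filtered F,
    meets_all F (closure A) &
    forall C, closed C -> C `<=` closure A -> meets_all F C -> C = closure A].

Definition directed (D : set T) : Prop :=
  D !=set0 /\ forall x y, D x -> D y -> exists2 z, D z & spec_le x z /\ spec_le y z.

Definition Dbar : set (set T) :=
  [set A | exists2 D, directed D & closure A = closure D].

Definition KFbar : set (set T) := [set A | kRudin QX A].

Definition has_greatest : Prop := exists t : T, forall x : T, spec_le x t.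

End Basics.

Definition homeomorphic (T1 T2 : topologicalType) : Prop :=
  exists (f : T1 -> T2) (g : T2 -> T1),
    [/\ cancel f g, cancel g f, continuous f & continuous g].

Definition subset_system := forall T : topologicalType, set (set T).

Definition is_Ksubset_system (Qk : subset_system) : Prop :=
  (forall T : topologicalType, @kolmogorov_space T ->
     (forall x : T, Qk T (upc x)) /\ Qk T `<=` QX) /\
  (forall (T1 T2 : topologicalType) (f : T1 -> T2),
     @kolmogorov_space T1 -> @kolmogorov_space T2 -> continuous f ->
     forall A : set T1, kRudin (Qk T1) A -> kRudin (Qk T2) (f @` A)).

(* Q_k(X) = {↑x | x in X}  (gives D(X)) *)
Definition Qd : subset_system := fun T => [set upc x | x in [set: T]].
(* Q_k(X) = Q(X)  (gives KF(X)) *)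
Definition Qwf : subset_system := fun T => @QX T.

(* The ambient space: subsets of X with the lower (hit) topology,       *)
(* generated by the sets U* = {C | C meets U}, U open.  All iterates     *)
(* K_beta(X) are realised as subspaces of it, a point [A] of K(Y) being  *)
(* identified with the closure in X of the union of (the points of) A.  *)
Definition hoare (T : topologicalType) : Type := set T.

HB.instance Definition _ (T : topologicalType) :=
  Choice.copy (hoare T) (set T).

HB.instance Definition _ (T : topologicalType) :=
  @isSubBaseTopological.Build (hoare T) (set T) open
    (fun U => [set C : hoare T | C `&` U !=set0]).

Definition Ksp (X : topologicalType) (P : set (hoare X)) : topologicalType :=
  set_type P.

(* X itself, as the set of point closures *)
Definition Kbase (X : topologicalType) : set (hoare X) :=
  [set closure [set x] | x in [set: X]].

(* K(Y) for Y = Ksp P, each class [A] identified with cl_X (union of A) *)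
Definition Kstep (Qk : subset_system) (X : topologicalType)
    (P : set (hoare X)) : set (hoare X) :=
  [set C | exists A : set (Ksp X P), kRudin (Qk (Ksp X P)) A /\
             C = closure (\bigcup_(c in A) (set_val c : set X))].

Definition is_succ (I : Type) (lt : I -> I -> Prop) (g b : I) : Prop :=
  lt g b /\ ~ exists d, lt g d /\ lt d b.

Definition iterK (Qk : subset_system) (X : topologicalType)
    (I : Type) (lt : I -> I -> Prop) (wf : well_founded lt) :
    I -> set (hoare X) :=
  Fix wf (fun _ => set (hoare X)) (fun b rec =>
    [set C | (exists g (h : lt g b), is_succ I lt g b /\ Kstep Qk X (rec g h) C) \/
             ((~ exists g, is_succ I lt g b) /\
              (Kbase X C \/ exists g (h : lt g b), rec g h C))]).

Definition Kit (Qk : subset_system) (X : topologicalType)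
    (I : Type) (lt : I -> I -> Prop) (wf : well_founded lt) (b : I) :
    topologicalType := Ksp X (iterK Qk X I lt wf b).

Definition rank_is (Qk : subset_system) (X : topologicalType)
    (I : Type) (lt : I -> I -> Prop) (wf : well_founded lt) (r : I) : Prop :=
  (exists2 r', is_succ I lt r r' & homeomorphic (Kit Qk X I lt wf r) (Kit Qk X I lt wf r')) /\
  (forall b b', lt b r -> is_succ I lt b b' ->
     ~ homeomorphic (Kit Qk X I lt wf b) (Kit Qk X I lt wf b')).

Definition special (Qk : subset_system) (X : topologicalType)
    (I : Type) (lt : I -> I -> Prop) (wf : well_founded lt) (r : I) : Prop :=
  rank_is Qk X I lt wf r /\ @has_greatest (Kit Qk X I lt wf r) /\
  (forall b, lt b r -> ~ @has_greatest (Kit Qk X I lt wf b)).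

(* Ordinals: an ordinal alpha is represented by a well-ordered type W    *)
(* (of order type alpha); ordinals <= alpha+2 by the type ext W, whose   *)
(* elements are Below w (w in W, the ordinals < alpha), Alpha (= alpha), *)
(* Alpha1 (= alpha+1), Alpha2 (= alpha+2).                               *)
Record wellorder := WellOrder {
  wo_car : Type;
  wo_lt : wo_car -> wo_car -> Prop;
  wo_wf : well_founded wo_lt;
  wo_trans : forall x y z, wo_lt x y -> wo_lt y z -> wo_lt x z;
  wo_total : forall x y, wo_lt x y \/ x = y \/ wo_lt y x }.

Inductive ext (W : Type) : Type :=
  | Below of W | Alpha | Alpha1 | Alpha2.
Arguments Below {W}. Arguments Alpha {W}. Arguments Alpha1 {W}. Arguments Alpha2 {W}.

Definition ext_lt (W : Type) (lt : W -> W -> Prop) (x y : ext W) : Prop :=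
  match x, y with
  | Below a, Below b => lt a b
  | Below _, _ => True
  | Alpha, Alpha1 | Alpha, Alpha2 | Alpha1, Alpha2 => True
  | _, _ => False
  end.

Lemma ext_lt_wf (W : Type) (lt : W -> W -> Prop) :
  well_founded lt -> well_founded (ext_lt W lt).
Proof.
move=> wf.
have hB : forall a, Acc (ext_lt W lt) (Below a).
  move=> a; elim: (wf a) => {}a _ IH; constructor.
  by case=> // b /= hb; apply: IH.
have hA : Acc (ext_lt W lt) (@Alpha W) by constructor; case.
have hA1 : Acc (ext_lt W lt) (@Alpha1 W) by constructor; case.
have hA2 : Acc (ext_lt W lt) (@Alpha2 W) by constructor; case.
by case.
Qed.

Definition ord_lt (a : wellorder) : ext (wo_car a) -> ext (wo_car a) -> Prop :=
  ext_lt (wo_car a) (wo_lt a).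
Definition ord_wf (a : wellorder) : well_founded (ord_lt a) :=
  ext_lt_wf (wo_car a) (wo_lt a) (wo_wf a).
Definition Kord (Qk : subset_system) (X : topologicalType) (a : wellorder)
  (b : ext (wo_car a)) : set (hoare X) :=
  iterK Qk X (ext (wo_car a)) (ord_lt a) (ord_wf a) b.
Definition Kord_sp (Qk : subset_system) (X : topologicalType) (a : wellorder)
  (b : ext (wo_car a)) : topologicalType := Ksp X (Kord Qk X a b).
Definition special_ord (Qk : subset_system) (X : topologicalType)
  (a : wellorder) (r : ext (wo_car a)) : Prop :=
  special Qk X (ext (wo_car a)) (ord_lt a) (ord_wf a) r.

(* Main.v *)
(* The witness comes from a well-founded tree of nodes with a greatest element.
   A node is a finite address [q_k; ...; q_1] of positions (level, n), where
   levels are -1 (written [None]) or ordinals and strictly decrease from alpha;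
   [q :: w] lies below [w] and below its siblings [p :: w] with q < p
   lexicographically, together with everything above those.  The children of a
   node of level >= 0 form a chain with that node as supremum, and upper sets
   are well-ordered chains.  X is the set of nodes of level -1 with the topology
   induced by the Scott topology.  A node of level b is a directed supremum of
   nodes of level < b but not of nodes whose levels are bounded below b, so the
   b-th iterate of D consists of the nodes of level < b; the root, of level
   alpha, first appears at stage alpha + 1, and there is nothing left to add.
   In such a tree an antichain has only its lower closure as Scott closure,
   which makes compact saturated sets so small that KF-Rudin sets have the same
   closures as directed sets; hence D, K and KF agree at every stage.  Distinct
   stages are not homeomorphic because the position of a node is determined by
   the specialization order below it. *)
Require Import Defs.
From HB Require Import structures.
From mathcomp Require Import all_boot all_order all_algebra.
From mathcomp Require Import all_classical.
From mathcomp Require Import topology.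

Local Open Scope classical_set_scope.

(** * The tree of nodes *)

Section Positions.
Variable alpha : wellorder.

Definition level := option (ext (wo_car alpha)).

Definition lev_lt (a b : level) : Prop :=
  match a, b with
  | None, Some _ => True
  | Some x, Some y => ord_lt alpha x y
  | _, None => False
  end.

Lemma ord_lt_trans (x y z : ext (wo_car alpha)) :
  ord_lt alpha x y -> ord_lt alpha y z -> ord_lt alpha x z.
Proof. by case: x y z => [x|||] [y|||] [z|||] //=; apply: wo_trans. Qed.

Lemma ord_lt_total (x y : ext (wo_car alpha)) :
  ord_lt alpha x y \/ x = y \/ ord_lt alpha y x.
Proof.
case: x y => [x|||] [y|||]; rewrite /ord_lt /=; auto.
by case: (wo_total alpha x y) => [|[->|]]; auto.
Qed.

Lemma lev_lt_trans (a b c : level) : lev_lt a b -> lev_lt b c -> lev_lt a c.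
Proof. by case: a b c => [a|] [b|] [c|] //=; apply: ord_lt_trans. Qed.

Lemma lev_lt_total (a b : level) : lev_lt a b \/ a = b \/ lev_lt b a.
Proof.
case: a b => [a|] [b|] /=; auto.
by case: (ord_lt_total a b) => [|[->|]]; auto.
Qed.

Lemma lev_lt_wf : well_founded lev_lt.
Proof.
have hN : Acc lev_lt None by constructor; case.
case=> [x|]; last exact: hN.
elim: (ord_wf alpha x) => {}x _ IH; constructor=> -[y|_]; [exact: IH|exact: hN].
Qed.

Definition position := (level * nat)%type.

Definition pos_lt (p q : position) : Prop :=
  lev_lt p.1 q.1 \/ p.1 = q.1 /\ (p.2 < q.2)%N.

Lemma pos_lt_trans p q r : pos_lt p q -> pos_lt q r -> pos_lt p r.
Proof.
case: p q r => [a i] [b j] [c k] [/= h|/= [-> h]] [/= h'|/= [<- h']].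
- by left; apply: lev_lt_trans h h'.
- by left.
- by left.
- by right; split=> //; apply: ltn_trans h h'.
Qed.

Lemma pos_lt_total p q : pos_lt p q \/ p = q \/ pos_lt q p.
Proof.
case: p q => [a i] [b j]; rewrite /pos_lt /=.
case: (lev_lt_total a b) => [|[->|]]; auto.
by case: (ltngtP i j) => [||->]; auto.
Qed.

Lemma pos_lt_wf : well_founded pos_lt.
Proof.
suff H a : forall n, Acc pos_lt (a, n) by case=> a n; apply: H.
elim: (lev_lt_wf a) => {}a _ IH n.
elim/ltn_ind: n => n IHn; constructor=> -[b m] [/= h|/= [-> h]]; [exact: IH|exact: IHn].
Qed.

Lemma pos_lt_irr p : ~ pos_lt p p.
Proof.
elim: (pos_lt_wf p) => {}p _ IH pp; exact: (IH p pp pp).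
Qed.

(** * Addresses and their order *)

Definition address := seq position.

(** The default gives the root, whose address is empty, the position [(Some Alpha, 0)]; all other
    nodes then have level below [alpha]. *)
Definition pos_of (l : address) : position := head (Some Alpha, 0%N) l.

Fixpoint address_ok (l : address) : Prop :=
  match l with
  | [::] => True
  | q :: l' => lev_lt q.1 (pos_of l').1 /\ address_ok l'
  end.

(** Above a larger sibling come only still larger siblings and what lies weakly above the common
    parent, so recursion through the parent alone already gives a transitive relation. *)
Fixpoint address_lt (u v : address) : Prop :=
  match u with
  | [::] => False
  | q :: u' => [\/ u' = v, exists2 p, v = p :: u' & pos_lt q p | address_lt u' v]
  end.

Lemma address_lt_trans u v w : address_lt u v -> address_lt v w -> address_lt u w.
Proof.
elim: u => // q u IH /= [<-|[p -> qp] /=|uv vw]; first by constructor 3.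
- case=> [<-|[r -> pr]|]; [by constructor 1| |by constructor 3].
  by constructor 2; exists r => //; apply: pos_lt_trans pr.
- by constructor 3; apply: IH.
Qed.

(** A parent has a larger level, a larger sibling a larger position. Irreflexivity and
    well-foundedness of [lt] come from this. *)
Lemma address_lt_pos u v : address_ok u -> address_lt u v -> pos_lt (pos_of u) (pos_of v).
Proof.
elim: u => // q u IH /= [qu oku] [<-|[p -> qp]|uv] //; first by left.
by apply: pos_lt_trans (IH oku uv); left.
Qed.

Lemma address_lt_up_total u v w : address_lt u v -> address_lt u w ->
  [\/ address_lt v w, v = w | address_lt w v].
Proof.
elim: u => // q u IH /= [<-|[p -> qp]|uv] [<-|[r -> qr]|uw].
- by constructor 2.
- by constructor 3; constructor 1.
- by constructor 1.
- by constructor 1; constructor 1.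
- case: (pos_lt_total p r) => [h|[->|h]].
  + by constructor 1; constructor 2; exists r.
  + by constructor 2.
  + by constructor 3; constructor 2; exists p.
- by constructor 1; constructor 3.
- by constructor 3.
- by constructor 3; constructor 3.
- exact: IH.
Qed.

(** Singles out the family of siblings from which the way up from [u] reaches [v], either at a
    larger sibling or at the parent [w]. *)
Lemma address_lt_decomp u v : address_ok u -> address_lt u v ->
  exists q w, [/\ address_ok (q :: w), u = q :: w \/ address_lt u (q :: w) &
    v = w \/ exists2 p, v = p :: w & pos_lt q p].
Proof.
elim: u => // q u IH /= [qu oku] [<-|[p -> qp]|uv].
- by exists q, u; split; auto.
- by exists q, u; split; auto; right; exists p.
- have [r [w [ok uw vw]]] := IH oku uv.
  exists r, w; split=> //; right.
  by case: uw => [->|]; [constructor 1|constructor 3].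
Qed.

Record node := Node { node_val : address; node_ok : address_ok node_val }.

HB.instance Definition _ := gen_eqMixin node.
HB.instance Definition _ := gen_choiceMixin node.

Lemma node_inj (x y : node) : node_val x = node_val y -> x = y.
Proof.
by case: x y => [u hu] [v hv] /= e; subst v; rewrite (Prop_irrelevance hu hv).
Qed.

Definition npos (x : node) : position := pos_of (node_val x).
Definition nlev (x : node) : level := (npos x).1.

Definition lt (x y : node) : Prop := address_lt (node_val x) (node_val y).
Definition le (x y : node) : Prop := x = y \/ lt x y.

Definition top : node := Node [::] I.

Lemma lt_trans x y z : lt x y -> lt y z -> lt x z.
Proof. exact: address_lt_trans. Qed.

Lemma le_lt_trans x y z : le x y -> lt y z -> lt x z.
Proof. by case=> [->//|]; apply: lt_trans. Qed.

Lemma lt_le_trans x y z : lt x y -> le y z -> lt x z.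
Proof. by move=> xy [<-//|]; apply: lt_trans. Qed.

Lemma le_trans x y z : le x y -> le y z -> le x z.
Proof. by case=> [->//|xy] yz; right; apply: lt_le_trans yz. Qed.

Lemma lt_npos x y : lt x y -> pos_lt (npos x) (npos y).
Proof. by apply: address_lt_pos; apply: node_ok. Qed.

Lemma lt_irr x : ~ lt x x.
Proof. by move=> /lt_npos /pos_lt_irr. Qed.

Lemma le_anti x y : le x y -> le y x -> x = y.
Proof. by case=> // xy yx; case: (@lt_irr x); apply: lt_le_trans yx. Qed.

Lemma lt_wf : well_founded lt.
Proof.
move=> x; move e: (npos x) => p; elim: (pos_lt_wf p) x e => {}p _ IH x e.
by constructor=> y /lt_npos yx; apply: IH erefl; rewrite -e.
Qed.

Lemma le_up_total x y z : le x y -> le x z -> le y z \/ le z y.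
Proof.
case=> [<-|xy]; first by left.
case=> [<-|xz]; first by right; right.
case: (address_lt_up_total _ _ _ xy xz) => [|/node_inj->|]; rewrite /le; auto.
Qed.

Lemma le_top x : le x top.
Proof.
case: x => u ok; case: u ok => [|q u] ok; first by left; apply: node_inj.
right; rewrite /lt /=; elim: u {ok} q => [|p u IH] q /=; first by constructor 1.
by constructor 3; apply: IH.
Qed.

Lemma le_nlev x y : le x y -> nlev x = nlev y \/ lev_lt (nlev x) (nlev y).
Proof. by case=> [->|/lt_npos [|[]]]; auto. Qed.

(** A smaller level is realised by a child of [s], a smaller index at the same level by a sibling;
    the root has index 0 and needs no sibling. *)
Lemma npos_below s v : pos_lt v (npos s) -> exists2 x, lt x s & npos x = v.
Proof.
case: s => w ok; rewrite /npos /= => -[h|[e h]].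
  by exists (Node (v :: w) (conj h ok)) => //; constructor 1.
case: w ok e h => [|p w] // ok e h.
have okv : address_ok (v :: w) by case: ok => /= h1 h2; split=> //=; rewrite e.
by exists (Node (v :: w) okv) => //; constructor 2; exists p => //; right.
Qed.

(** * Chains and their suprema *)

Definition chain (E : set node) : Prop :=
  E !=set0 /\ forall x y, E x -> E y -> le x y \/ le y x.

Definition is_sup (E : set node) (s : node) : Prop :=
  (forall x, E x -> le x s) /\ forall u, (forall x, E x -> le x u) -> le s u.

(** All upper bounds lie above one element [e], hence are comparable, so a minimal one is least. *)
Lemma chain_sup E : chain E -> exists s, is_sup E s.
Proof.
move=> [[e Ee] _].
pose U := [set u | forall x, E x -> le x u].
suff H : forall u, U u -> exists s, is_sup E s by apply: (H top) => x _; apply: le_top.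
move=> u; elim: (lt_wf u) => {}u _ IH Uu.
have [[v Uv vu]|nv] := pselect (exists2 v, U v & lt v u); first exact: (IH v).
exists u; split=> // v Uv.
case: (le_up_total e u v (Uu _ Ee) (Uv _ Ee)) => // -[->|vu]; first by left.
by case: nv; exists v.
Qed.

Lemma singleton_chain s : chain [set s] /\ is_sup [set s] s.
Proof.
split; split.
- by exists s.
- by move=> x y -> ->; left; left.
- by move=> x ->; left.
- by move=> u; apply.
Qed.

(** The children of [s] form the chain. None of them bounds it, since raising the index of a
    position gives a larger child of the same level. *)
Lemma node_is_sup s b : nlev s = Some b -> exists E : set node,
  [/\ chain E, forall e, E e -> lev_lt (nlev e) (Some b), is_sup E s &
      forall e, E e -> lt e s].
Proof.
case: s => w ok; rewrite /nlev /npos /= => e.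
pose s := Node w ok.
pose E := [set x : node | exists q, node_val x = q :: w].
have Elt x : E x -> lt x s by move=> [q eq]; rewrite /lt eq; constructor 1.
exists E; split=> //.
- split.
    have ok0 : address_ok ((None, 0%N) :: w) by split=> //; rewrite e.
    by exists (Node _ ok0); exists (None, 0%N).
  move=> x y [p ep] [q eq]; rewrite /le /lt ep eq.
  case: (pos_lt_total p q) => [h|[h|h]].
  + by left; right; constructor 2; exists q.
  + by left; left; apply: node_inj; rewrite ep eq h.
  + by right; right; constructor 2; exists p.
- by case=> v okv [q /= eq]; subst v; rewrite -e /nlev /=; case: okv.
- split=> [x /Elt|u Eu]; first by right.
  have ok0 : address_ok ((None, 0%N) :: w) by split=> //; rewrite e.
  have notE : ~ E u.
    move=> [q eq]; have := node_ok u; rewrite eq => -[qw _].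
    have ok1 : address_ok ((q.1, q.2.+1) :: w) by split.
    have /Eu h : E (Node _ ok1) by exists (q.1, q.2.+1).
    apply: (@lt_irr u); apply: lt_le_trans h; rewrite /lt eq.
    by constructor 2; exists (q.1, q.2.+1) => //; right.
  have : le (Node _ ok0) u by apply: Eu; exists (None, 0%N).
  case=> [eu|]; first by case: notE; rewrite -eu; exists (None, 0%N).
  case=> /= [wu|[q uq _]|wu].
  + by left; apply: node_inj.
  + by case: notE; exists q.
  + by right.
Qed.

(* An element [e] of [E] sits weakly below some [q :: w] where [s] is [w] or a
   larger sibling of [q :: w].  If the level of [s] exceeded [g], then
   [max q (g, 0) :: w] would still bound [E] while lying strictly below [s]. *)
Lemma sup_level E s g : chain E ->
  (forall e, E e -> lev_lt (nlev e) (Some g)) -> is_sup E s ->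
  nlev s = Some g \/ lev_lt (nlev s) (Some g).
Proof.
move=> [[e Ee] cE] Eg [Es sE].
have [gs|[|]] := lev_lt_total (Some g) (nlev s); auto.
have Elt x : E x -> lt x s.
  move=> Ex; case: (Es _ Ex) => // exs; case: (@pos_lt_irr (Some g, 0%N)).
  by left; apply: lev_lt_trans gs _; rewrite -exs; apply: Eg.
have [q [w [okq eq sw]]] := address_lt_decomp _ _ (node_ok e) (Elt _ Ee).
have [v [okv vs qv gv]] : exists v, [/\ address_ok (v :: w),
    address_lt (v :: w) (node_val s), q = v \/ pos_lt q v &
    (Some g, 0%N) = v \/ pos_lt (Some g, 0%N) v].
  case: (pos_lt_total (Some g, 0%N) q) => gq.
    exists q; split=> //; [|by left|by right].
    by case: sw => [->|[p -> qp]]; [constructor 1|constructor 2; exists p].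
  have gw : lev_lt (Some g) (pos_of w).1.
    case: sw => [<-//|[p sp _]]; apply: lev_lt_trans gs _.
    by have := node_ok s; rewrite /nlev /npos sp => -[].
  exists (Some g, 0%N); split; [by split=> //; case: okq| |by case: gq => [<-|]; auto|by left].
  case: sw => [->|[p sp _]]; first by constructor 1.
  rewrite sp; constructor 2; exists p => //; left.
  by move: gs; rewrite /nlev /npos sp.
pose u := Node (v :: w) okv.
have us : lt u s by [].
have eu : le e u.
  apply: (le_trans _ (Node (q :: w) okq)).
    by case: eq => [eq|]; [left; apply: node_inj|right].
  case: qv => [qv|qv]; first by left; apply: node_inj; rewrite /= qv.
  by right; constructor 2; exists v.
case: (@lt_irr u); apply: lt_le_trans us _; apply: sE => z Ez.
have zs := Elt _ Ez.
case: (cE _ _ Ez Ee) => [ze|ez]; first exact: le_trans eu.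
case: (le_up_total e z u ez eu) => // -[<-|uz]; first by left.
have absz : ~ le s z by move=> sz; apply: (@lt_irr s); apply: le_lt_trans zs.
have wz_absurd (okw : address_ok w) : ~ le (Node w okw) z.
  move=> wz; case: absz; apply: le_trans wz; case: sw => [sw|[p sp _]].
    by left; apply: node_inj.
  by right; rewrite /lt sp; constructor 1.
have okw : address_ok w := okv.2.
(* A member [z] strictly above [u] would be a sibling of [u] of level at least [g], or lie weakly
   above [w] and hence above [s]. *)
case: uz => /= [wz|[p zp vp]|wz].
- by case: (wz_absurd okw); left; apply: node_inj.
- have := Eg _ Ez; rewrite /nlev /npos zp /= => pg.
  case: (@pos_lt_irr (Some g, 0%N)).
  have gp : pos_lt (Some g, 0%N) p by case: gv => [->//|gv]; apply: pos_lt_trans vp.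
  by apply: pos_lt_trans gp _; left.
- by case: (wz_absurd okw); right.
Qed.

(** * Scott topology *)

(** Chains suffice in place of directed sets: the members of a directed set above a fixed member
    form a cofinal chain, as upper sets are chains. *)
Definition scott_closed (F : set node) : Prop :=
  (forall x y, F y -> le x y -> F x) /\
  forall E s, chain E -> E `<=` F -> is_sup E s -> F s.

Lemma scott_closed_down s : scott_closed [set x | le x s].
Proof.
split=> [x y ys xy|E u _ Es [_ uE]]; first exact: le_trans ys.
by apply: uE => x; apply: Es.
Qed.

(** If some [e] in the chain is outside [F], the tail above [e] avoids [F], hence lies in [G], and
    has the same supremum. *)
Lemma scott_closedU F G : scott_closed F -> scott_closed G -> scott_closed (F `|` G).
Proof.
move=> [Fd Fs] [Gd Gs]; split=> [x y [Fy|Gy] xy|E s cE EFG sE].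
- by left; apply: Fd xy.
- by right; apply: Gd xy.
have [EF|/existsNP[e /not_implyP[Ee nFe]]] := pselect (E `<=` F).
  by left; apply: Fs sE.
right; apply: (Gs (E `&` [set x | le e x])).
- split; first by exists e; split=> //; left.
  by move=> x y [Ex _] [Ey _]; apply: cE.2.
- by move=> x [Ex ex]; case: (EFG _ Ex) => // Fx; case: nFe; apply: Fd ex.
- split=> [x [Ex _]|u Eu]; first exact: sE.1.
  apply: sE.2 => x Ex; case: (cE.2 _ _ Ee Ex) => [ex|xe]; first exact: Eu.
  by apply: (le_trans _ _ _ xe); apply: Eu; split=> //; left.
Qed.

Lemma scott_closed_bigcap (I : Type) (F : I -> set node) :
  (forall i, scott_closed (F i)) -> scott_closed (\bigcap_i F i).
Proof.
move=> cF; split=> [x y Fy xy i _|E s cE EF sE i _].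
  by apply: (cF i).1 xy; apply: Fy.
by apply: (cF i).2 sE => // x /EF; apply.
Qed.

(* Upper sets are chains, so a chain of elements below an antichain stays below
   one single member of it. *)
Lemma scott_closed_antichain (A : set node) :
  (forall x y, A x -> A y -> le x y -> x = y) ->
  scott_closed [set x | exists2 a, A a & le x a].
Proof.
move=> anti; split=> [x y [a Aa ya] xy|E s [[e Ee] cE] EA [Es sE]].
  by exists a => //; apply: le_trans ya.
have [a Aa ea] := EA _ Ee; exists a => //; apply: sE => x Ex.
have [b Ab xb] := EA _ Ex.
case: (cE _ _ Ex Ee) => [xe|ex]; first exact: le_trans ea.
have eb : le e b by apply: le_trans xb.
by case: (le_up_total e a b ea eb) => [/anti->|/anti<-].
Qed.

Local Lemma scott_openT : scott_closed (~` [set: node]).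
Proof. by rewrite setCT; split=> // E s [[e Ee] _] /(_ _ Ee). Qed.

Local Lemma scott_openI : setI_closed [set U | scott_closed (~` U)].
Proof. by move=> U V hU hV; rewrite /= setCI; apply: scott_closedU. Qed.

Local Lemma scott_open_bigU (I : Type) (f : I -> set node) :
  (forall i, scott_closed (~` f i)) -> scott_closed (~` \bigcup_i f i).
Proof. by move=> hf; rewrite setC_bigcup; apply: scott_closed_bigcap. Qed.

HB.instance Definition _ :=
  isOpenTopological.Build node scott_openT scott_openI scott_open_bigU.

Lemma closed_scott (F : set node) : closed F <-> scott_closed F.
Proof. by rewrite -openC -[X in _ <-> scott_closed X]setCK. Qed.

End Positions.

(** * Specialization order and k-Rudin sets *)

Section General.
Context {T : topologicalType}.

Lemma closure_min (A B : set T) : closed B -> A `<=` B -> closure A `<=` B.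
Proof. by move=> cB AB; rewrite closureE; apply: smallest_sub. Qed.

Lemma spec_leP (x y : T) : spec_le x y <-> forall C, closed C -> C y -> C x.
Proof.
rewrite /spec_le; split=> [xy C cC Cy|H].
  by apply: (closure_min [set y] C cC) xy => _ ->.
by apply: H; [exact: closed_closure|apply: subset_closure].
Qed.

Lemma spec_le_refl (x : T) : spec_le x x.
Proof. by apply/spec_leP. Qed.

Lemma spec_le_trans (x y z : T) : spec_le x y -> spec_le y z -> spec_le x z.
Proof. by move=> /spec_leP xy /spec_leP yz; apply/spec_leP => C cC /yz-/(_ cC) /xy; apply. Qed.

Lemma kolmogorovP :
  (forall x y : T, spec_le x y -> spec_le y x -> x = y) -> kolmogorov_space T.
Proof.
move=> anti x y /eqP xy.
suff [C [cC]] : exists C, closed C /\ (C x /\ ~ C y \/ C y /\ ~ C x).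
  have nb z : ~ C z -> nbhs z (~` C).
    by move=> Cz; apply: open_nbhs_nbhs; split=> //; apply: closed_openC.
  case=> -[Cz nC]; exists (~` C); rewrite !inE setCK; [right|left]; by split=> //; apply: nb.
have [xley|/spec_leP/existsNP[C]] := pselect (spec_le x y); last first.
  by move=> /not_implyP[cC /not_implyP[Cy nCx]]; exists C; auto.
have [ylex|/spec_leP/existsNP[C]] := pselect (spec_le y x); last first.
  by move=> /not_implyP[cC /not_implyP[Cx nCy]]; exists C; auto.
by case: xy; apply: anti.
Qed.

Lemma compact_upc (x : T) : compact (upc x).
Proof.
move=> F PF Fx; exists x; split; first exact: spec_le_refl.
move=> A B FA xB; have [z [xz Az]] : (upc x `&` A) !=set0.
  by apply: (@filter_ex _ F PF); exact: filterI.
exists z; split=> //.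
by have [w [-> ]] := xz (interior B) (nbhs_interior xB); apply: interior_subset.
Qed.

Lemma QX_upc (x : T) : QX (upc x).
Proof.
split; first by exists x; apply: spec_le_refl.
by split; [exact: compact_upc|move=> y z xy; apply: spec_le_trans].
Qed.

Lemma kRudin_mono (Q Q' : set (set T)) (A : set T) :
  Q `<=` Q' -> kRudin Q A -> kRudin Q' A.
Proof.
move=> QQ' [A0 [F [FQ fF mF minF]]]; split=> //; exists F; split=> //.
exact: subset_trans QQ'.
Qed.

(** The family is that of all [upc x] with [x] in [D]: a closed set is a lower set, so it meets
    [upc x] only if it contains [x]. *)
Lemma directed_kRudin (Q : set (set T)) (D : set T) :
  (forall x, Q (upc x)) -> directed D -> kRudin Q D.
Proof.
move=> Qup [[d Dd] dD]; split; first by exists d.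
exists [set upc x | x in D]; split.
- by move=> _ [x _ <-].
- split; first by exists (upc d); exists d.
  move=> _ _ [x Dx <-] [y Dy <-]; have [z Dz [xz yz]] := dD _ _ Dx Dy.
  by exists (upc z); [exists z|move=> w zw; split; apply: spec_le_trans zw].
- move=> _ [x Dx <-]; exists x; split; first exact: subset_closure.
  exact: spec_le_refl.
- move=> C cC CD mC; apply/seteqP; split=> //; apply: closure_min => // x Dx.
  have [|y [Cy xy]] := mC (upc x); first by exists x.
  by move/spec_leP: xy; apply.
Qed.

Lemma kRudin_closure (Q : set (set T)) (A B : set T) :
  closure A = closure B -> kRudin Q A -> kRudin Q B.
Proof.
move=> AB [[a Aa] [F [FQ fF mF minF]]]; split.
  have : closure B a by rewrite -AB; apply: subset_closure.
  by move=> /(_ setT filterT) [b [Bb _]]; exists b.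
by exists F; rewrite -AB.
Qed.

End General.

Lemma spec_le_continuous (T U : topologicalType) (f : T -> U) (x y : T) :
  continuous f -> spec_le x y -> spec_le (f x) (f y).
Proof.
move=> /continuous_closedP cf /spec_leP xy; apply/spec_leP => C cC Cy.
exact: (xy (f @^-1` C)) (cf C cC) Cy.
Qed.

(** Common ground of [Qd], [Qk] and [Qwf], so that one computation of the iterates serves all
    three. *)
Definition between_Qd_QX (Qk : subset_system) := forall T : topologicalType,
  kolmogorov_space T -> (forall x : T, Qk T (upc x)) /\ Qk T `<=` QX.

Lemma between_Qd : between_Qd_QX Qd.
Proof.
move=> T _; split=> [x|_ [x _ <-]]; first by exists x.
exact: QX_upc.
Qed.

Lemma between_Qwf : between_Qd_QX Qwf.
Proof. by move=> T _; split=> // x; apply: QX_upc. Qed.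

(** * The iterates of X *)

Section Stages.
Variable alpha : wellorder.
Local Notation node := (node alpha).
Local Notation ext := (ext (wo_car alpha)).
Local Notation le := (le alpha).
Local Notation lt := (lt alpha).
Local Notation scott_closed := (scott_closed alpha).

Definition base : topologicalType := set_type [set x : node | nlev alpha x = None].

Definition base_val (x : base) : node := set_val x.

Lemma base_lev (x : base) : nlev alpha (base_val x) = None.
Proof. exact: (set_valP x). Qed.

Lemma base_val_surj s : nlev alpha s = None -> exists x : base, base_val x = s.
Proof.
move=> hs; have h : [set x : node | nlev alpha x = None] s by [].
by exists (SigSub (mem_set h)).
Qed.

Lemma closed_base (C : set base) :
  closed C <-> exists2 F, scott_closed F & C = base_val @^-1` F.
Proof.
split=> [/closed_openC[U oU UC]|[F cF ->]].
  exists (~` U); first by apply/closed_scott; apply: open_closedC.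
  by rewrite -[C]setCK -UC.
move/closed_scott: cF => /closed_openC oF; rewrite -openC.
by exists (~` F).
Qed.

(* The points of the sobrification of [base] are the sets [trace s]. *)
Definition trace (s : node) : hoare base := base_val @^-1` [set x | le x s].

(** Every node is an iterated supremum of nodes of level [None], so those below [s] force [s] into
    any Scott closed set containing them. *)
Lemma scott_closed_trace F s :
  scott_closed F -> (trace s `<=` base_val @^-1` F) <-> F s.
Proof.
move=> cF; split=> [|Fs x xs]; last exact: cF.1 xs.
elim: (lt_wf alpha s) => {}s _ IH sF.
case e: (nlev alpha s) => [b|].
  have [E [cE _ sE Es]] := node_is_sup alpha s b e.
  apply: cF.2 sE => // x Ex; apply: IH => [|y yx]; first exact: Es.
  by apply: sF; apply: le_trans yx _; right; apply: Es.
have [x xs] := base_val_surj _ e.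
by rewrite -xs; apply: sF; rewrite /trace /= xs; left.
Qed.

Lemma trace_sub s u : trace s `<=` trace u -> le s u.
Proof. by move/(scott_closed_trace _ _ (scott_closed_down alpha u)). Qed.

Lemma trace_inj s u : trace s = trace u -> s = u.
Proof. by move=> e; apply: le_anti; apply: trace_sub; rewrite e. Qed.

Lemma closed_trace s : closed (trace s : set base).
Proof. by apply/closed_base; exists [set x | le x s] => //; apply: scott_closed_down. Qed.

Lemma closure_trace (A : set base) s :
  (forall F, scott_closed F -> A `<=` base_val @^-1` F <-> F s) ->
  closure A = trace s.
Proof.
move=> As; apply/seteqP; split.
  apply: closure_min; first exact: closed_trace.
  by apply/(As _ (scott_closed_down alpha s)); left.
have /closed_base [F cF AF] := @closed_closure _ A.
by rewrite AF; apply/scott_closed_trace/As => //; rewrite -AF; apply: subset_closure.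
Qed.

(** If [F] cuts out the complement of [U], then [trace s] meets [U] exactly when [s] is outside
    [F]. *)
Lemma continuous_trace (O : set (hoare base)) : open O -> open (trace @^-1` O).
Proof.
case=> D sD <-; rewrite preimage_bigcup; apply: bigcup_open => A /sD.
case=> E EU <-; rewrite openE => s sE.
rewrite preimage_bigcap; apply: filter_bigI => U UE.
apply: open_nbhs_nbhs; split; last exact: sE.
have oU : open U by apply: set_mem; apply: EU.
have [F cF UF] : exists2 F, scott_closed F & ~` U = base_val @^-1` F.
  by apply/closed_base; apply: open_closedC.
rewrite -[X in open X]setCK openC closed_scott (_ : ~` _ = F) //.
apply/seteqP; split=> u.
  move=> nU; apply/(scott_closed_trace _ _ cF); rewrite -UF => x xu Ux.
  by apply: nU; exists x.
by move/(scott_closed_trace _ _ cF); rewrite -UF => uF [x [/uF]].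
Qed.

Lemma kolmogorov_base : kolmogorov_space base.
Proof.
have spec (x y : base) : spec_le x y -> le (base_val x) (base_val y).
  move=> /spec_leP xy; have := xy (trace (base_val y)); apply; last by left.
  exact: closed_trace.
apply: kolmogorovP => x y /spec xy /spec yx; apply: val_inj.
exact: le_anti xy yx.
Qed.

(** * The stages and their k-Rudin sets *)

Definition stage (b : ext) : set node := [set s | lev_lt alpha (nlev alpha s) (Some b)].

Definition stage_traces (b : ext) : set (hoare base) := trace @` stage b.

Section Stage.
Variable b : ext.
Local Notation Y := (Ksp base (stage_traces b)).

Lemma stage_node_subproof (y : Y) : exists2 s, stage b s & trace s = set_val y.
Proof. exact: (set_valP y). Qed.

Definition stage_node (y : Y) : node := s2val (cid2 (stage_node_subproof y)).

Lemma stage_nodeP y : stage b (stage_node y).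
Proof. exact: (s2valP (cid2 (stage_node_subproof y))). Qed.

Lemma trace_stage_node y : trace (stage_node y) = set_val y.
Proof. exact: (s2valP' (cid2 (stage_node_subproof y))). Qed.

Lemma stage_node_inj y z : stage_node y = stage_node z -> y = z.
Proof.
move=> e; apply: val_inj; rewrite -[val y]trace_stage_node e; exact: trace_stage_node.
Qed.

Lemma stage_node_surj s : stage b s -> exists y, stage_node y = s.
Proof.
move=> bs; have h : stage_traces b (trace s) by exists s.
exists (SigSub (mem_set h)); apply: trace_inj; exact: trace_stage_node.
Qed.

Lemma closed_stage (C : set Y) :
  closed C <-> exists2 F, scott_closed F & C = stage_node @^-1` F.
Proof.
split=> [/closed_openC[O oO OC]|[F cF ->]].
  exists (~` (trace @^-1` O)).
    by apply/closed_scott/open_closedC; apply: continuous_trace.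
  rewrite -[C]setCK -OC; apply/seteqP; split=> y /=; by rewrite trace_stage_node.
rewrite -openC.
have oU : open (~` (base_val @^-1` F)) by apply/closed_openC/closed_base; exists F.
exists [set C : hoare base | C `&` ~` (base_val @^-1` F) !=set0].
  exists [set [set C : hoare base | C `&` ~` (base_val @^-1` F) !=set0]].
    by move=> _ ->; apply: finI_from1.
  by rewrite bigcup_set1.
apply/seteqP; split=> y /=; rewrite -trace_stage_node.
  by move=> [x [xy nFx]] /(scott_closed_trace _ _ cF) /(_ x xy).
move=> nF; apply: contrapT => nx; apply: nF; apply/(scott_closed_trace _ _ cF) => x xy.
by apply: contrapT => nFx; apply: nx; exists x.
Qed.

Lemma spec_le_stage y z : spec_le y z <-> le (stage_node y) (stage_node z).
Proof.
split=> [/spec_leP H|yz].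
  apply: (H (stage_node @^-1` [set x | le x (stage_node z)])); last by left.
  by apply/closed_stage; exists [set x | le x (stage_node z)] => //; apply: scott_closed_down.
by apply/spec_leP => _ /closed_stage [F cF ->] Fz; apply: cF.1 yz.
Qed.

Lemma kolmogorov_stage : kolmogorov_space Y.
Proof.
apply: kolmogorovP => y z /spec_le_stage yz /spec_le_stage zy.
by apply: stage_node_inj; apply: le_anti.
Qed.

Definition stage_pre (E : set node) : set Y := stage_node @^-1` E.

Lemma stage_pre_sub E F : E `<=` stage b -> stage_pre E `<=` stage_pre F -> E `<=` F.
Proof. by move=> Eb EF x Ex; have [y yx] := stage_node_surj _ (Eb _ Ex); move: Ex; rewrite -yx; apply: EF. Qed.

Lemma directed_stage_pre E : chain alpha E -> E `<=` stage b -> directed (stage_pre E).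
Proof.
move=> [[e Ee] cE] Eb; split.
  by have [y ye] := stage_node_surj _ (Eb _ Ee); exists y; rewrite /stage_pre /= ye.
move=> y z Ey Ez; case: (cE _ _ Ey Ez) => [yz|zy]; [exists z|exists y] => //;
  by split; apply/spec_le_stage => //; left.
Qed.

Lemma closure_bigcup_trace (A : set Y) s :
  (forall F, scott_closed F -> A `<=` stage_node @^-1` F <-> F s) ->
  closure (\bigcup_(c in A) (set_val c : set base)) = trace s.
Proof.
move=> As; apply: closure_trace => F cF; rewrite -(As F cF); split=> H.
  move=> y Ay; apply/(scott_closed_trace _ _ cF) => x xy.
  by apply: H; exists y => //; rewrite -trace_stage_node.
move=> x [y Ay]; rewrite -trace_stage_node => xy.
by move: x xy; apply/(scott_closed_trace _ _ cF)/H.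
Qed.

(** This is the point that [Kstep] assigns to the class of [A]: a Scott closed set contains [E]
    exactly when it contains [s]. *)
Lemma closure_bigcup_chain (A : set Y) E s : chain alpha E -> E `<=` stage b ->
  is_sup alpha E s -> closure A = closure (stage_pre E) ->
  closure (\bigcup_(c in A) (set_val c : set base)) = trace s.
Proof.
move=> cE Eb sE AE; apply: closure_bigcup_trace => F cF.
have clF : closed (stage_node @^-1` F) by apply/closed_stage; exists F.
have sub B : B `<=` stage_node @^-1` F <-> closure B `<=` stage_node @^-1` F.
  by split=> [|h]; [exact: closure_min|apply: subset_trans h; apply: subset_closure].
rewrite sub AE -sub; split=> [/(stage_pre_sub _ _ Eb) EF|Fs y Ey].
  exact: cF.2 sE.
by apply: cF.1 Fs _; apply: sE.1.
Qed.

Lemma stage_min_below (K : set Y) x : K x -> exists m, [/\ K m,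
  forall y, K y -> spec_le y m -> y = m & spec_le m x].
Proof.
move e: (stage_node x) => s; elim: (lt_wf alpha s) x e => {}s _ IH x e Kx.
have [[y [Ky yx]]|nx] := pselect (exists y, K y /\ lt (stage_node y) (stage_node x)).
  rewrite e in yx; have [m [Km mm my]] := IH _ yx y erefl Ky.
  exists m; split=> //; apply: spec_le_trans my _.
  by apply/spec_le_stage; rewrite e; right.
exists x; split=> //; last exact: spec_le_refl.
move=> y Ky /spec_le_stage[/stage_node_inj//|yx].
by case: nx; exists y.
Qed.

Lemma spec_le_up_total (x y z : Y) : spec_le x y -> spec_le x z -> spec_le y z \/ spec_le z y.
Proof.
move=> /spec_le_stage xy /spec_le_stage xz.
by case: (le_up_total _ _ _ _ xy xz) => h; [left|right]; apply/spec_le_stage.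
Qed.

(* If no [C ∩ ↑m] with [m] minimal in [K0] were dense in [C], then for every
   such [m] some [K m] in the family would avoid its closure.  A cluster point
   in [K0] of the minimal elements, taken along the filtered family, lies above
   some minimal [m0], but it also lies in the closure of an antichain of other
   minimal elements, i.e. below one of them. *)
Lemma kRudin_QX_chain (A : set Y) : kRudin QX A ->
  exists E, [/\ chain alpha E, E `<=` stage b & closure A = closure (stage_pre E)].
Proof.
move=> [_ [F [FQ [[K0 FK0] filF] mF minF]]].
set C := closure A in mF minF *.
have cC : closed C by apply: closed_closure.
pose M := [set m | K0 m /\ forall y, K0 y -> spec_le y m -> y = m].
pose D m := C `&` upc m.
have DC m : closure (D m) `<=` C by apply: closure_min => // x [].
(* If the closure of [D m] meets the whole family, minimality of [C] makes it equal to [C]; and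
   [D m], lying in [upc m], is a chain. *)
have [[m [Mm mD]]|nM] := pselect (exists m, M m /\ meets_all F (closure (D m))).
  have eC := minF _ (@closed_closure _ _) (DC m) mD.
  exists (stage_node @` D m); split.
  - split.
      have [y [Dy _]] := mD _ FK0.
      by have [z [Dz _]] := Dy setT filterT; exists (stage_node z), z.
    move=> _ _ [y [_ my] <-] [z [_ mz] <-].
    by case: (spec_le_up_total _ _ _ my mz) => /spec_le_stage; auto.
  - by move=> _ [y _ <-]; apply: stage_nodeP.
  - rewrite -eC; congr closure; apply/seteqP; split=> y; first by exists y.
    by move=> [z Dz /stage_node_inj <-].
pose M' K := [set m | M m /\ C `&` K `&` upc m !=set0].
pose G := filter_from F M'.
have M'0 K : F K -> M' K !=set0.
  move=> FK; have [K1 FK1 K1K] := filF _ _ FK FK0.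
  have [x [Cx K1x]] := mF _ FK1; have [Kx K0x] := K1K _ K1x.
  by have [m [Km mm mx]] := stage_min_below _ _ K0x; exists m; split=> //; exists x.
have PG : ProperFilter G.
  apply: filter_from_proper => //; apply: filter_from_filter; first by exists K0.
  move=> K L FK FL; have [H FH HKL] := filF _ _ FK FL; exists H => //.
  move=> m [Mm [x [[Cx Hx] mx]]]; have [Kx Lx] := HKL _ Hx.
  by split; split=> //; exists x.
have GK0 : G K0 by exists K0 => // m [[]].
have [y [K0y cly]] := (FQ _ FK0).2.1 G PG GK0.
have [m0 [K0m0 minm0 m0y]] := stage_min_below _ _ K0y.
have /existsNP[K /not_implyP[FK KD]] : ~ meets_all F (closure (D m0)).
  by move=> h; apply: nM; exists m0.
pose N := [set m | M m /\ m <> m0].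
have M'N : M' K `<=` N.
  move=> m [Mm [x [[Cx Kx] mx]]]; split=> // e; apply: KD; exists x; split=> //.
  by apply: subset_closure; rewrite -e.
pose P := [set x | exists2 a, (stage_node @` N) a & le x a].
have cP : scott_closed P.
  apply: scott_closed_antichain => _ _ [m [[Km mm] _] <-] [n [[Kn mn] _] <-] mn'.
  by congr stage_node; apply: mn => //; apply/spec_le_stage.
have : closure (stage_node @^-1` P) y.
  move=> B yB; have [z [Mz Bz]] : (M' K `&` B) !=set0 by apply: cly => //; exists K.
  by exists z; split=> //; exists (stage_node z); [exists z => //; apply: M'N|left].
have cP' : closed (stage_node @^-1` P) by apply/closed_stage; exists P.
move=> /cP' [_ [m [[K0m mm] mm0] <-]] /spec_le_stage ym.
by case: mm0; apply/esym/mm => //; apply: spec_le_trans ym.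
Qed.

Lemma Dbar_stage : @Dbar Y = KFbar.
Proof.
apply/seteqP; split=> A.
  move=> [D dD AD]; apply: (kRudin_closure _ D A) => //.
  by apply: directed_kRudin dD; apply: QX_upc.
move=> /kRudin_QX_chain [E [cE Eb AE]].
by exists (stage_pre E) => //; apply: directed_stage_pre.
Qed.

(** The new points are the suprema of chains in [stage b]: [sup_level] bounds their levels by [b],
    and [node_is_sup] attains every node of level [b]. *)
Lemma Kstep_stage (Qk : subset_system) b' : between_Qd_QX Qk ->
  is_succ _ (ord_lt alpha) b b' ->
  Kstep Qk base (stage_traces b) = stage_traces b'.
Proof.
move=> /(_ Y kolmogorov_stage) [Qup QQ] [bb' nb]; apply/seteqP; split=> C.
  move=> [A [/(kRudin_mono _ _ _ QQ) /kRudin_QX_chain [E [cE Eb AE]] ->]].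
  have [s sE] := chain_sup alpha E cE.
  exists s; last by rewrite (closure_bigcup_chain A E s).
  case: (sup_level alpha E s b cE Eb sE) => h; first by rewrite /stage /= h.
  exact: (lev_lt_trans alpha _ (Some b) (Some b') h bb').
move=> [s bs <-].
have [E [cE Eb sE]] : exists E, [/\ chain alpha E, E `<=` stage b & is_sup alpha E s].
  case: (lev_lt_total alpha (nlev alpha s) (Some b)) => [h|[h|h]].
  - by have [cs ss] := singleton_chain alpha s; exists [set s]; split=> // _ ->.
  - by have [E [cE Eb sE _]] := node_is_sup alpha s b h; exists E.
  - by move: h bs; rewrite /stage /=; case: (nlev alpha s) => // c bc cb'; case: nb; exists c.
exists (stage_pre E); split; last by rewrite (closure_bigcup_chain _ E s).
by apply: directed_kRudin => //; apply: directed_stage_pre.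
Qed.

End Stage.

(** * Computation of the iterates *)

Lemma Kbase_traces : Kbase base = trace @` [set s | nlev alpha s = None].
Proof.
have cl x : closure [set x] = trace (base_val x).
  apply: closure_trace => F cF; split=> [|Fx _ ->//]; exact.
apply/seteqP; split=> C.
  by move=> [x _ <-]; exists (base_val x); rewrite ?cl //; apply: base_lev.
by move=> [s /base_val_surj[x <-] <-]; exists x.
Qed.

Lemma Kord_stage (Qk : subset_system) b : between_Qd_QX Qk ->
  Kord Qk base alpha b = stage_traces b.
Proof.
move=> bQ; elim: (ord_wf alpha b) => {}b _ IH.
rewrite /Kord /iterK Fix_eq; last first.
  move=> x f g fg; suff -> : f = g by [].
  by do 2!apply: functional_extensionality_dep => ?; apply: fg.
apply/seteqP; split=> C.
  move=> [[g [gb [succ]]]|[nsucc [|[g [gb]]]]].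
  - by rewrite -/(iterK _ _ _ _ _ _) -/(Kord _ _ _ _) IH // (Kstep_stage g Qk b).
  - by rewrite Kbase_traces => -[s sN <-]; exists s => //; rewrite /stage /= sN.
  - rewrite -/(iterK _ _ _ _ _ _) -/(Kord _ _ _ _) IH // => -[s sg <-].
    by exists s => //; apply: (lev_lt_trans alpha _ (Some g) (Some b) sg).
have [[g succ]|nsucc] := pselect (exists g, is_succ _ (ord_lt alpha) g b).
  move=> bC; left; exists g, succ.1; split=> //.
  by rewrite -/(iterK _ _ _ _ _ _) -/(Kord _ _ _ _) IH ?(Kstep_stage g Qk b) //; case: succ.
move=> [s sb <-]; right; split=> //.
case e: (nlev alpha s) sb => [c|] sb; last first.
  by left; rewrite Kbase_traces; exists s.
right; have cb : ord_lt alpha c b by move: sb; rewrite /stage /= e.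
(* As [b] has no predecessor, some [d] lies strictly between [c] and [b], and the node already
   belongs to stage [d]. *)
have [d [cd db]] : exists d, ord_lt alpha c d /\ ord_lt alpha d b.
  by apply: contrapT => nd; apply: nsucc; exists c.
exists d, db; rewrite -/(iterK _ _ _ _ _ _) -/(Kord _ _ _ _) IH //.
by exists s => //; rewrite /stage /= e.
Qed.

(** * Greatest elements and ranks *)

(** Every stage contains all nodes of level [None], and the only upper bound of these is the
    root. *)
Lemma stage_greatest b :
  @has_greatest (Ksp base (stage_traces b)) <-> lev_lt alpha (Some Alpha) (Some b).
Proof.
split=> [[t tP]|bA].
  suff -> : Some Alpha = nlev alpha (stage_node b t) by apply: stage_nodeP.
  suff <- : top alpha = stage_node b t by [].
  apply: le_anti; last exact: le_top.
  apply/(scott_closed_trace _ _ (scott_closed_down alpha _)) => x _.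
  have [|y yx] := stage_node_surj b (base_val x).
    by rewrite /stage /= base_lev.
  by rewrite /preimage /= -yx; apply/spec_le_stage.
have [y yt] := stage_node_surj b (top alpha) bA.
by exists y => x; apply/spec_le_stage; rewrite yt; apply: le_top.
Qed.

(* The positions occurring strictly below a node are exactly those smaller than
   its own, so an isomorphism between two stages, both being lower sets of
   nodes, preserves positions. *)
Lemma homeomorphic_stages b c :
  homeomorphic (Ksp base (stage_traces b)) (Ksp base (stage_traces c)) ->
  forall s, stage b s -> exists2 t, stage c t & npos alpha t = npos alpha s.
Proof.
move=> [f [g [fK gK cf cg]]].
have stage_down d x y : stage d y -> lt x y -> stage d x.
  move=> dy xy; have [|h] := le_nlev alpha x y (or_intror xy).
    by rewrite /stage /= => ->.
  exact: (lev_lt_trans alpha _ _ (Some d) h).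
have lt_spec d (x y : Ksp base (stage_traces d)) :
    lt (stage_node d x) (stage_node d y) <-> spec_le x y /\ x <> y.
  split=> [xy|[/spec_le_stage[/stage_node_inj//|//]]].
  split; first by apply/spec_le_stage; right.
  by move=> e; apply: (lt_irr alpha (stage_node d y)); rewrite -{1}e.
have flt x y : lt (stage_node b x) (stage_node b y) ->
    lt (stage_node c (f x)) (stage_node c (f y)).
  move=> /lt_spec[xy nxy]; apply/lt_spec; split.
    exact: spec_le_continuous xy.
  by move=> /(can_inj fK).
have glt x y : lt (stage_node c x) (stage_node c y) ->
    lt (stage_node b (g x)) (stage_node b (g y)).
  move=> /lt_spec[xy nxy]; apply/lt_spec; split.
    exact: spec_le_continuous xy.
  by move=> /(can_inj gK).
suff H s : forall y, stage_node b y = s -> npos alpha (stage_node c (f y)) = npos alpha s.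
  move=> s /stage_node_surj [y ys]; exists (stage_node c (f y)).
    exact: stage_nodeP.
  exact: H.
elim: (lt_wf alpha s) => {}s _ IH y ys.
(* If the positions differ, [npos_below] puts the smaller one strictly below the node with the
   larger; by induction its image under [f] or [g] then has the position of a node strictly above
   it. *)
case: (pos_lt_total alpha (npos alpha (stage_node c (f y))) (npos alpha s)) => [h|[//|h]].
  have [x xs ex] := npos_below _ _ _ h.
  have [z zx] : exists z, stage_node b z = x.
    by apply: stage_node_surj; apply: (stage_down _ _ _ _ xs); rewrite -ys; apply: stage_nodeP.
  rewrite -zx -ys in xs.
  have := lt_npos _ _ _ (flt _ _ xs); rewrite (IH x _ _ zx) -?ys -?zx //.
  by rewrite zx ex => /pos_lt_irr.
have [x xy ex] := npos_below _ _ _ h.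
have [z zx] : exists z, stage_node c z = x.
  by apply: stage_node_surj; apply: (stage_down _ _ _ _ xy); apply: stage_nodeP.
rewrite -zx in xy; have := glt _ _ xy; rewrite fK ys => gzs.
have := IH _ gzs _ erefl; rewrite gK zx ex => e.
by have := lt_npos _ _ _ gzs; rewrite -e => /pos_lt_irr.
Qed.

Lemma stage_special (Qk : subset_system) : between_Qd_QX Qk ->
  special_ord Qk base alpha Alpha1.
Proof.
move=> bQ; have K b : iterK Qk base _ (ord_lt alpha) (ord_wf alpha) b = stage_traces b.
  exact: Kord_stage.
split; [split|split].
- exists Alpha2; first by split=> // -[[w|||] []].
  (* No level exceeds [alpha], so both stages consist of all nodes. *)
  rewrite /Kit !K (_ : stage_traces Alpha2 = stage_traces Alpha1).
    by exists id, id; split=> // x; apply: cvg_id.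
  congr image; apply/seteqP; split=> s; rewrite /stage /=; last first.
    by move=> h; apply: lev_lt_trans h _.
  have [->//|] := le_nlev alpha s (top alpha) (le_top alpha s).
  by move=> h _; apply: lev_lt_trans h _.
- move=> b b' bA [bb' _]; rewrite /Kit !K => hom.
  have [s bs] : exists s, nlev alpha s = Some b.
    case: (lev_lt_total alpha (Some b) (Some Alpha)) => [h|[e|h]].
    + have [|s _ es] := npos_below alpha (top alpha) (Some b, 0%N); first by left.
      by exists s; rewrite /nlev es.
    + by exists (top alpha).
    + by case: b bA h {hom bb'}.
  have [f [g [fK gK cf cg]]] := hom.
  (* The larger stage comes first: it has a node of level [b], whose position would have to recur in
     [stage b]. *)
  have hom' : homeomorphic (Ksp base (stage_traces b')) (Ksp base (stage_traces b)).
    by exists g, f.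
  have bs' : stage b' s by rewrite /stage /= bs.
  have [t bt et] := homeomorphic_stages b' b hom' s bs'.
  have tb : nlev alpha t = Some b by rewrite -bs /nlev et.
  apply: (pos_lt_irr alpha (Some b, 0%N)); left.
  by move: bt; rewrite /stage /= tb.
- by rewrite /Kit K; apply/stage_greatest.
- move=> b bA; rewrite /Kit K => /stage_greatest.
  by case: b bA.
Qed.
End Stages.

Theorem mainTheorem12 (Qk : subset_system) (HQk : is_Ksubset_system Qk)
  (alpha : wellorder) :
  exists X : topologicalType,
    @kolmogorov_space X /\
    [/\ (* (1) X is (alpha+1)^d-special and (alpha+1)^wf-special *)
        special_ord Qd X alpha Alpha1 /\ special_ord Qwf X alpha Alpha1,
        (* (2) for all 0 <= m < alpha+1 *)
        (forall m m' : ext (wo_car alpha),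
           ord_lt alpha m Alpha1 -> is_succ _ (ord_lt alpha) m m' ->
           @Dbar (Kord_sp Qk X alpha m) = @KFbar (Kord_sp Qk X alpha m) /\
           (Kord Qd X alpha m' = Kord Qk X alpha m' /\
            Kord Qk X alpha m' = Kord Qwf X alpha m')) &
        (* (3) X is (alpha+1)^k-special *)
        special_ord Qk X alpha Alpha1].
Proof.
have bQ : between_Qd_QX Qk by case: HQk.
exists (base alpha); split.
  exact: kolmogorov_base.
split.
- by split; apply: stage_special; [exact: between_Qd|exact: between_Qwf].
- move=> m m' _ _.
  rewrite /Kord_sp !(Kord_stage _ _ _ bQ) (Kord_stage _ _ _ between_Qd).
  by rewrite (Kord_stage _ _ _ between_Qwf); split=> //; apply: Dbar_stage.
- exact: stage_special.
Qed.
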